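(* There exist an absolute constant $c>0$ and an integer $k_0$ such that for every integer $k\ge k_0$ there exist an undirected edge-weighted graph $G$ and a subset $T\subseteq V(G)$ with $|T|=k$ such that every SPR solution $H$ of $G$ with respect to $T$ has stretch at least $c\sqrt{\log k/\log\log k}$.
   Context: Logarithms are base 2. For an undirected graph $G$ with nonnegative edge weights, $\mathrm{dist}_G(u,v)$ denotes the shortest-path distance. A graph $H$ is a minor of $G$ if $H$ can be obtained from $G$ by edge deletions, vertex deletions and edge contractions. Given $G$ and a set $T\subseteq V(G)$ of terminals, an SPR (Steiner point removal) solution is a minor $H$ of $G$ with $V(H)=T$, equipped with arbitrary edge weights, such that for some real $\alpha\ge 1$ and all $t,t'\in T$: $\mathrm{dist}_G(t,t')\le \mathrm{dist}_H(t,t')\le \alpha\cdot \mathrm{dist}_G(t,t')$. The smallest such $\alpha$ is the stretch of $H$. *)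

(* Defs.v *)
From HB Require Import structures.
From mathcomp Require Import all_boot all_order all_algebra.
From mathcomp Require Import all_classical all_reals all_analysis.

Set Implicit Arguments.
Unset Strict Implicit.
Unset Printing Implicit Defensive.

Import Order.TTheory GRing.Theory Num.Theory.

Local Open Scope classical_set_scope.
Local Open Scope ring_scope.

(* Finite simple graphs whose vertices are drawn from an ambient finite type
   [V]; an edge is a two-element set of vertices.  The vertex set is a subset
   of [V] (not all of it), so that a minor of [G] lives over the same [V]. *)
Record graph (V : finType) := Graph {
  vert : {set V};
  edges : {set {set V}};
  edges_wf : [forall e in edges, (e \subset vert) && (#|e| == 2%N)]
}.

Definition adj (V : finType) (G : graph V) : rel V :=
  fun x y => [set x; y]%SET \in edges G.

Definition rename (V : finType) (u v : V) : V -> V :=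
  fun x => if x == v then u else x.

Definition rename_edge (V : finType) (u v : V) (e : {set V}) : {set V} :=
  (rename u v @: e)%SET.

(* Contracting the edge uv gives the merged vertex the name u; since {u, v} is
   unordered, either endpoint may be the one whose name survives.  The
   condition #|e| == 2 discards the loop created by uv itself, and parallel
   edges are identified. *)
Inductive minor_step (V : finType) (G H : graph V) : Prop :=
| DeleteEdge e of
    e \in edges G & vert H = vert G & edges H = (edges G :\ e)%SET
| DeleteVertex x of
    x \in vert G & vert H = (vert G :\ x)%SET &
    edges H = [set e in edges G | x \notin e]%SET
| ContractEdge u v of
    [set u; v]%SET \in edges G & vert H = (vert G :\ v)%SET &
    edges H = [set e in rename_edge u v @: edges G
                | #|e| == 2%N]%SET.

(* [minor G H]: H is obtained from G by a finite sequence of steps.  Vertices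
   keep their names, so [vert H = T] says that the vertices of H are the
   terminals themselves, each t having absorbed the vertices contracted
   into it. *)
Inductive minor (V : finType) (G : graph V) : graph V -> Prop :=
| minor_refl : minor G G
| minor_trans_step H K of minor G H & minor_step H K : minor G K.

Record wgraph (R : realType) (V : finType) := WGraph {
  wgraph_graph :> graph V;
  weight : {set V} -> R;
  weight_ge0 : forall e, e \in edges wgraph_graph -> 0 <= weight e
}.

Definition walk_weight (R : realType) (V : finType) (G : wgraph R V)
    (x : V) (p : seq V) : R :=
  \sum_(a <- pairmap (fun y z => weight G [set y; z]%SET) x p) a.

(* The value is +oo when x and y are not connected. *)
Definition dist (R : realType) (V : finType) (G : wgraph R V) (x y : V)
    : \bar R :=
  ereal_inf [set (walk_weight G x p)%:E
            | p in [set p : seq V | path (adj G) x p /\ last x p = y]].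

Definition has_stretch (R : realType) (V : finType) (G : wgraph R V)
    (T : {set V}) (H : wgraph R V) (alpha : R) : Prop :=
  1 <= alpha /\
  forall t t', t \in T -> t' \in T ->
    (dist G t t' <= dist H t t' /\ dist H t t' <= alpha%:E * dist G t t')%E.

Definition spr_solution (R : realType) (V : finType) (G : wgraph R V)
    (T : {set V}) (H : wgraph R V) : Prop :=
  [/\ minor G H, vert H = T & exists alpha : R, has_stretch G T H alpha].

(* For an SPR solution this infimum is a minimum, see [stretch_min]. *)
Definition stretch (R : realType) (V : finType) (G : wgraph R V)
    (T : {set V}) (H : wgraph R V) : R :=
  inf [set alpha : R | has_stretch G T H alpha].

Lemma stretch_min (R : realType) (V : finType) (G : wgraph R V)
    (T : {set V}) (H : wgraph R V) : spr_solution G T H ->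
  has_stretch G T H (stretch G T H) /\
  forall alpha, has_stretch G T H alpha -> stretch G T H <= alpha.
Proof.
case=> _ _ [a0 Ha0].
have lb : lbound [set alpha : R | has_stretch G T H alpha] 1 by move=> a [].
have le_inf a : has_stretch G T H a -> stretch G T H <= a.
  by move=> Ha; apply: ge_inf => //; exists 1.
have ge1 : 1 <= stretch G T H by apply: lb_le_inf => //; exists a0.
split=> //; split=> // t t' tT t'T.
have [le0 le1] := Ha0.2 t t' tT t'T; split=> //.
have hub a : has_stretch G T H a -> (dist H t t' <= a%:E * dist G t t')%E.
  by move=> Ha; have [] := Ha.2 t t' tT t'T.
have s_gt0 : 0 < stretch G T H by apply: lt_le_trans ge1.
move: le1 hub; case: (dist G t t') => [r||] le1 hub.
- case: (dist H t t') le1 hub => [h||] // _ hub; last by rewrite leNye.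
  have hub' a : has_stretch G T H a -> h <= a * r.
    by move=> /hub; rewrite -EFinM lee_fin.
  rewrite -EFinM lee_fin.
  have [r_gt0|r_le0] := ltP 0 r.
    rewrite -ler_pdivrMr //; apply: lb_le_inf; first by exists a0.
    by move=> a /hub'; rewrite ler_pdivrMr.
  by apply: (le_trans (hub' _ Ha0)); apply: ler_wnM2r => //; apply: le_inf.
- by rewrite gt0_muley ?lte_fin // leey.
- by move: le1; rewrite !gt0_muleNy ?lte_fin // (lt_le_trans _ Ha0.1).
Qed.

Definition log2 (R : realType) (x : R) : R := ln x / ln 2.

(* Main.v *)
Require Import Defs.
From HB Require Import structures.
From mathcomp Require Import all_boot all_order all_algebra.
From mathcomp Require Import all_classical all_reals all_analysis.
From mathcomp Require Import seq fintype finset zify lra.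

(* Take a core graph on k vertices of girth > 4w^2 with at least 2k edges, all
   of weight 1, where w is of order sqrt(log k), and hang a terminal on every
   core vertex by an edge of weight w.  Let H be a solution of stretch
   alpha < w/4.  Each branch set then has radius at most w^2 around its
   terminal, less than half the girth, so branch sets induce trees and contain
   at most k of the core edges.  The other core edges, which cross between
   branch sets, are at least as many as the core vertices, so they contain a
   cycle, and hence a path P of w crossing edges.  The ends of P have terminals
   at distance at most 3w, so H connects these by a walk of weight at most
   about 3w alpha < w^2.  Replace each step of that walk by a shortest path of
   G.  Such a path has at most one crossing edge, because by the girth it is
   contained in the path through the two branch sets.  Again by the girth, the
   resulting walk contains P, so H uses at least w steps, each of weight at
   least about w, which forces alpha >= w/4. *)

Set Implicit Arguments.
Unset Strict Implicit.
Unset Printing Implicit Defensive.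

(** * Walks, their edges, and girth *)

Section Walks.
Variable V : finType.
Implicit Types (x y u v : V) (p q : seq V) (e r : rel V).

Definition walk_edges x p : seq {set V} := pairmap (fun y z => [set y; z]) x p.

Lemma set2_eq x y u v :
  [set x; y] = [set u; v] -> (x = u /\ y = v) \/ (x = v /\ y = u).
Proof.
move=> E.
have xuv : x \in [set u; v] by rewrite -E set21.
have yuv : y \in [set u; v] by rewrite -E set22.
have uxy : u \in [set x; y] by rewrite E set21.
have vxy : v \in [set x; y] by rewrite E set22.
case/set2P: xuv => ?; subst x; [left|right]; split=> //.
- by case/set2P: yuv vxy => // -> /set2P [] ->.
- by case/set2P: yuv uxy => // -> /set2P [] ->.
Qed.

Lemma walk_edges_cat x p q :
  walk_edges x (p ++ q) = walk_edges x p ++ walk_edges (last x p) q.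
Proof. exact: pairmap_cat. Qed.

Lemma walk_edges_mem x p u v :
  [set u; v] \in walk_edges x p -> (u \in x :: p) && (v \in x :: p).
Proof.
elim: p x => [//|y p IH] x; rewrite [walk_edges _ _]/= in_cons.
case/orP=> [/eqP/set2_eq [] [-> ->]|/IH/andP [up vp]].
- by rewrite !inE !eqxx orbT.
- by rewrite !inE !eqxx orbT.
- by rewrite ![_ \in [:: x, y & p]]in_cons up vp !orbT.
Qed.

Lemma walk_edges_head x p y :
  uniq (x :: p) -> [set x; y] \in walk_edges x p -> y = head x p.
Proof.
case: p => [//|z p] /= /andP [xNp _]; rewrite in_cons.
case/orP=> [/eqP/set2_eq [] [] // xz _|/walk_edges_mem/andP [xp _]].
  by rewrite xz mem_head in xNp.
by rewrite xp in xNp.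
Qed.

Lemma walk_edges_uniq x p : uniq (x :: p) -> uniq (walk_edges x p).
Proof.
elim: p x => [//|y p IH] x /= /andP [xNp yp]; rewrite (IH y) // andbT.
by apply: contra xNp => /walk_edges_mem/andP [].
Qed.

Lemma walk_edges_split x p s : s \in walk_edges x p ->
  exists p1 y p2, p = p1 ++ y :: p2 /\ s = [set last x p1; y].
Proof.
elim: p x => [//|y p IH] x; rewrite [walk_edges _ _]/= in_cons.
case/orP=> [/eqP ->|/IH [p1 [z [p2 [-> ->]]]]]; first by exists [::], y, p.
by exists (y :: p1), z, p2.
Qed.

Lemma path_walk_edges r x p :
  (forall u v, [set u; v] \in walk_edges x p -> r u v) -> path r x p.
Proof.
elim: p x => [//|y p IH] x H /=; rewrite H ?mem_head //=.
by apply: IH => u v uv; apply: H; rewrite in_cons uv orbT.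
Qed.

Lemma walk_edges_path r x p u v :
  symmetric r -> path r x p -> [set u; v] \in walk_edges x p -> r u v.
Proof.
move=> r_sym; elim: p x => [//|y p IH] x /= /andP [xy yp].
rewrite in_cons => /orP [/eqP/set2_eq [] [-> ->] //|]; last exact: IH.
by rewrite r_sym.
Qed.

(** Like every walk here, the list leaves out its starting vertex, which is now [last x p]. *)
Definition rev_walk x p := rev (belast x p).

Lemma last_rev_walk x p : last (last x p) (rev_walk x p) = x.
Proof. by rewrite /rev_walk; case: p => //= y p; rewrite rev_cons last_rcons. Qed.

Lemma size_rev_walk x p : size (rev_walk x p) = size p.
Proof. by rewrite size_rev size_belast. Qed.

Lemma rev_walk_path r x p :
  symmetric r -> path r (last x p) (rev_walk x p) = path r x p.
Proof. by move=> r_sym; rewrite rev_path; apply: eq_path => a b; apply: r_sym. Qed.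

Lemma walk_edges_rev x p :
  walk_edges (last x p) (rev_walk x p) =i walk_edges x p.
Proof.
rewrite /rev_walk; elim: p x => [//|y p IH] x s /=.
rewrite rev_cons -cats1 walk_edges_cat mem_cat IH.
have -> : last (last y p) (rev (belast y p)) = y by exact: last_rev_walk.
by rewrite /= !in_cons in_nil orbF orbC setUC.
Qed.

Lemma uniq_subwalk r x p : path r x p -> exists q,
  [/\ path r x q, uniq (x :: q), last x q = last x p & size q <= size p].
Proof.
case/shortenP=> q xq q_uniq qp; exists q; split=> //.
by apply: uniq_leq_size => //; case/andP: q_uniq.
Qed.

(* The closing walk together with the edge xy is a closed walk through xy of
   length [(size p).+1], so this says that every cycle is longer than [g]. *)
Definition girth_gt (g : nat) e := forall x y p, e x y -> path e x p ->
  last x p = y -> [set x; y] \notin walk_edges x p -> g <= size p.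

(** If the first edge of [p] were missing from [q], then [q] followed by the rest of [p] backwards
    would close too short a cycle through it. The rest of [p] is compared by induction with
    [x :: q]: the total length is unchanged, and the extra edge is not in the rest of [p], as [p] is
    simple. *)
Lemma girth_cover g e x p q : symmetric e -> girth_gt g e ->
  path e x p -> uniq (x :: p) -> path e x q -> last x q = last x p ->
  size p + size q <= g -> {subset walk_edges x p <= walk_edges x q}.
Proof.
move=> e_sym girth.
elim: p x q => [//|y p IH] x q; rewrite [path e x _]/= [last x (y :: p)]/=.
move=> /andP [xy yp] /andP [xNp yp_uniq] xq lq szq s.
have xyq : [set x; y] \in walk_edges x q.
  apply: contraT => xyNq.
  have : g <= size (q ++ rev_walk y p).
    apply: (girth x y _ xy).
    - by rewrite cat_path xq lq rev_walk_path.
    - by rewrite last_cat lq last_rev_walk.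
    - rewrite walk_edges_cat mem_cat negb_or xyNq lq walk_edges_rev.
      by apply: contra xNp => /walk_edges_mem/andP [].
  by rewrite size_cat size_rev_walk; move: szq => /=; lia.
rewrite [walk_edges x (y :: p)]/= in_cons => /orP [/eqP -> //|sp].
have := IH y (x :: q) yp yp_uniq _ _ _ s sp.
rewrite /= e_sym xy xq in_cons => /(_ isT lq) H.
have /orP [/eqP sE|//] : (s == [set y; x]) || (s \in walk_edges x q).
  by apply: H; move: szq => /=; lia.
by move: sp xNp; rewrite sE => /walk_edges_mem/andP [_ ->].
Qed.

End Walks.

(** * Dense graphs of large girth by edge-maximality *)

Section Greedy.
Variable U : finType.

Fixpoint ball (r : rel U) (x : U) (k : nat) : {set U} :=
  if k is k'.+1 then x |: \bigcup_(y | r x y) ball r y k' else [set x].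

Lemma ballP (r : rel U) x p k :
  path r x p -> size p <= k -> last x p \in ball r x k.
Proof.
elim: p x k => [|y p IH] x [|k] //=; rewrite ?set11 ?setU11 //.
move=> /andP [xy yp] sp; apply/setUP; right.
by apply/bigcupP; exists y => //; apply: IH.
Qed.

Lemma card_ball (r : rel U) d x k :
  (forall y, #|[set z | r y z]| <= d) -> #|ball r x k| <= d.+1 ^ k.
Proof.
move=> deg; elim: k x => [|k IH] x /=; first by rewrite cards1.
apply: leq_trans (leq_card_setU _ _) _; rewrite cards1.
have : #|\bigcup_(y | r x y) ball r y k| <= \sum_(y | r x y) #|ball r y k|.
  elim/big_ind2: _ => [|m A n B mA nB|//]; first by rewrite cards0.
  by apply: leq_trans (leq_card_setU _ _) _; apply: leq_add.
have : \sum_(y | r x y) #|ball r y k| <= \sum_(y | r x y) d.+1 ^ k.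
  by apply: leq_sum.
have dx : #|r x| <= d by rewrite -cardsE; exact: deg.
rewrite sum_nat_const expnS; have : 0 < d.+1 ^ k by rewrite expn_gt0.
move=> pos sum_le U_le; apply: leq_trans (_ : 1 + #|r x| * d.+1 ^ k <= _).
  by rewrite leq_add2l (leq_trans U_le).
by nia.
Qed.

(** Edges form a finite set of ordered pairs, so that one of maximum cardinality can be chosen; each
    undirected edge counts twice. *)
Definition good_graph (d g : nat) (E : {set U * U}) : Prop :=
  let e := [rel x y | (x, y) \in E] in
  [/\ symmetric e, irreflexive e, forall x, #|[set y | e x y]| <= d
    & girth_gt g e].

(** A cycle through the new edge leaves, once that edge is removed, an old walk between [x] and [y],
    which is long by assumption; any other cycle is old. *)
Lemma girth_gt_add_edge (e : rel U) g x y :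
  symmetric e -> girth_gt g e ->
  (forall p, path e x p -> last x p = y -> g <= size p) ->
  girth_gt g [rel u v | e u v || ([set u; v] == [set x; y])].
Proof.
move=> e_sym girth far a b p0 ab p0P lp0 abNp0.
(* Excluding ab from the relation ensures that the simple path extracted from [p0] avoids it too. *)
pose e' := [rel u v | (e u v || ([set u; v] == [set x; y]))
                      && ([set u; v] != [set a; b])].
have e'_sym : symmetric e'.
  by move=> u v; rewrite /e' /= e_sym [[set u; v]]setUC.
have /uniq_subwalk [p [pP p_uniq lp]] : path e' a p0.
  apply: path_walk_edges => u v uv /=; apply/andP; split.
    apply: (walk_edges_path _ p0P uv) => u' v' /=.
    by rewrite e_sym [[set u'; v']]setUC.
  by apply: contraNneq abNp0 => <-.
apply: leq_trans; rewrite lp0 in lp.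
have abNp u v : [set u; v] \in walk_edges a p -> [set u; v] != [set a; b].
  by move=> /(walk_edges_path e'_sym pP)/andP [].
have pathE z q : path e' z q -> [set x; y] \notin walk_edges z q -> path e z q.
  move=> qP xyNq; apply: path_walk_edges => u v uv.
  have /andP [/orP [//|/eqP uvxy] _] := walk_edges_path e'_sym qP uv.
  by rewrite -uvxy uv in xyNq.
have [xyp|xyNp] := boolP ([set x; y] \in walk_edges a p); last first.
  have pE := pathE _ _ pP xyNp.
  have [abe|abE] := orP ab; last first.
    have [[ax byy]|[ay bx]] := set2_eq (eqP abE).
      by apply: (far p); rewrite -ax // -byy.
    have := far (rev_walk a p); rewrite size_rev_walk -bx -lp last_rev_walk.
    by rewrite rev_walk_path //; apply.
  apply: (girth a b) => //.
  by apply/negP => /abNp; rewrite eqxx.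
have [p1 [z [p2 [pE xyE]]]] := walk_edges_split xyp.
have abe : e a b.
  have [//|abE] := orP ab.
  by have := abNp _ _ xyp; rewrite (eqP abE) eqxx.
move: pP p_uniq lp; rewrite pE cat_path -cat_cons cat_uniq last_cat.
case/andP=> p1P /andP [_ p2P] /and3P [_ /hasPn p12 _] lp; rewrite /= in lp.
have zNp1 : z \notin a :: p1 by apply: p12; rewrite mem_head.
have lNp2 : last a p1 \notin z :: p2.
  by apply: contraL (mem_last a p1); apply: p12.
have p1E : path e a p1.
  by apply: pathE => //; rewrite xyE; apply: contra zNp1 => /walk_edges_mem/andP [].
have p2E : path e z p2.
  by apply: pathE => //; rewrite xyE; apply: contra lNp2 => /walk_edges_mem/andP [].
(* This goes round the cycle without xy: from [z] to [b], across ab to [a], and on to the other end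
   of xy. It is as long as [p]. *)
pose q := p2 ++ a :: p1.
have qP : path e z q by rewrite cat_path p2E lp /= e_sym abe.
have lq : last z q = last a p1 by rewrite last_cat lp.
have -> : size (p1 ++ z :: p2) = size q by rewrite !size_cat /= addnS addnC addnS.
have [[xl yz]|[xz yl]] := set2_eq xyE; last by apply: far; rewrite xz // lq -yl.
rewrite -(size_rev_walk z); apply: far; rewrite xl -lq ?rev_walk_path //.
by rewrite last_rev_walk.
Qed.

Lemma good_graph_add_edge d g (E : {set U * U}) x y :
  let e := [rel x y | (x, y) \in E] in
  good_graph d g E -> x != y -> #|[set z | e x z]| < d ->
  #|[set z | e y z]| < d ->
  (forall p, path e x p -> last x p = y -> g <= size p) ->
  good_graph d g ((x, y) |: ((y, x) |: E)).
Proof.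
move=> e [e_sym e_irr e_deg e_girth] xy dx dy far.
have eE u v : ((u, v) \in (x, y) |: ((y, x) |: E)) =
    e u v || ([set u; v] == [set x; y]).
  rewrite !inE !xpair_eqE /e /= orbA orbC; congr (_ || _).
  apply/orP/eqP => [[]/andP [/eqP -> /eqP ->] //|]; first by rewrite setUC.
  by case/set2_eq => [[-> ->]|[-> ->]]; rewrite !eqxx; [left|right].
split=> [u v|u|u|].
- by rewrite /= !eE setUC (e_sym u v : e u v = e v u).
- rewrite /= eE (e_irr u : e u u = false) /=; apply/negP => /eqP/set2_eq [] [ux uy];
  by rewrite -ux -uy eqxx in xy.
- pose s := if u == x then [set y] else if u == y then [set x] else set0.
  have sub : [set z | ((u, z) \in (x, y) |: ((y, x) |: E))]
      \subset [set z | e u z] :|: s.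
    apply/subsetP => z; rewrite inE eE in_setU inE /s.
    case/orP => [->//|/eqP/set2_eq [] [-> ->]]; rewrite eqxx ?set11 ?orbT //.
    by rewrite eq_sym (negPf xy) set11 orbT.
  apply: leq_trans (subset_leq_card sub) _.
  apply: leq_trans (leq_card_setU _ _) _; rewrite /s.
  case: (u =P x) => [->|_]; first by rewrite cards1 addn1.
  case: (u =P y) => [->|_]; first by rewrite cards1 addn1.
  by rewrite cards0 addn0 e_deg.
- have := girth_gt_add_edge e_sym e_girth far.
  move=> girth a b p ab pP; apply: girth; first by rewrite /= -(eE a b).
  by rewrite -(eq_path (e := [rel u v | (u, v) \in (x, y) |: ((y, x) |: E)])).
Qed.

(* In an edge-maximal graph of girth > g and maximum degree <= d, two vertices
   of degree < d are at distance < g, for otherwise they could be joined. *)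
Lemma large_girth_graph d g : 0 < g -> 2 * d.+1 ^ g <= #|U| ->
  exists e : rel U, [/\ symmetric e, irreflexive e, girth_gt g e &
    d * #|U| <= 2 * #|[set xy | e xy.1 xy.2]|].
Proof.
move=> g_gt0 dgU.
pose P m := `[< exists2 E : {set U * U}, good_graph d g E & #|E| = m >].
have P0 : exists m, P m.
  exists 0; apply/asboolP; exists set0; last by rewrite cards0.
  split=> [x y|x|x|x y p] /=; rewrite ?inE //.
  by rewrite (_ : [set y | _] = set0) ?cards0 //; apply/setP => y; rewrite !inE.
have Pub m : P m -> m <= #|{: U * U}|.
  by move=> /asboolP [E _ <-]; apply: max_card.
case: (ex_maxnP P0 Pub) => _ /asboolP [E E_good <-] E_max.
have [e_sym e_irr e_deg e_girth] := E_good.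
set e := [rel x y | _] in e_sym e_irr e_deg e_girth.
exists e; split=> //.
(* The vertices of deficient degree lie in a single ball, so they are at most half of [U]; the
   others alone supply enough edges. *)
pose A := [set x | #|[set y | e x y]| < d].
have A_le : #|A| <= d.+1 ^ g.
  have [->|[x xA]] := set_0Vmem A; first by rewrite cards0.
  apply: leq_trans (card_ball x g e_deg); apply/subset_leq_card/subsetP => y yA.
  apply: contraT => yNB.
  have far p : path e x p -> last x p = y -> g <= size p.
    move=> pP lp; apply: contraT; rewrite -ltnNge => /ltnW/(ballP pP).
    by rewrite lp (negPf yNB).
  have xy : x != y.
    apply: contraNneq yNB => <-.
    by have := @ballP e x [::] g isT isT.
  have xyNE : (x, y) \notin E.
    apply: contra yNB => xyE; apply: (@ballP e x [:: y]) => //=.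
    by rewrite xyE.
  rewrite !inE in xA yA.
  have := good_graph_add_edge E_good xy xA yA far.
  set E' := _ |: _ => E'_good.
  have : #|E'| <= #|E| by apply: E_max; apply/asboolP; exists E'.
  rewrite /E' cardsU1 !inE (negPf xyNE) orbF xpair_eqE (negPf xy) /= add1n.
  by rewrite ltnNge subset_leq_card // subsetUr.
have -> : [set xy | e xy.1 xy.2] = E by apply/setP => -[x y]; rewrite inE.
have cardE : #|E| = \sum_x #|[set y | e x y]|.
  rewrite -sum1_card (eq_bigl (fun xy => xpredT xy.1 && e xy.1 xy.2)); last first.
    by case.
  rewrite -(pair_big_dep xpredT e (fun _ _ => 1)) /=.
  by apply: eq_bigr => x _; rewrite sum1dep_card.
have : d * #|~: A| <= #|E|.
  rewrite cardE (bigID (mem A)) /= addnC mulnC -sum_nat_const.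
  apply: leq_trans (leq_addr _ _); rewrite (eq_bigl (fun x => x \notin A)).
    by apply: leq_sum => x; rewrite inE -leqNgt.
  by move=> x; rewrite inE.
have : #|U| <= 2 * #|~: A| by have := cardsC A; lia.
move=> UA dE; apply: leq_trans (leq_mul (leqnn d) UA) _.
by rewrite mulnCA leq_mul2l dE orbT.
Qed.

End Greedy.

(** * Long paths in dense graphs of large girth *)

Section LongPath.
Variable U : finType.
Implicit Types (e r : rel U) (S : {set U}).

(** Since ordered pairs are counted, the assumption is that there are at least as many edges as
    vertices. Removing a vertex of degree at most 1 preserves this, and it fails for a single
    vertex, so the removals stop earlier. *)
Lemma dense_core r S : symmetric r -> irreflexive r -> 0 < #|S| ->
  2 * #|S| <= #|[set xy | [&& xy.1 \in S, xy.2 \in S & r xy.1 xy.2]]| ->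
  exists2 S' : {set U}, S' != set0 &
    forall x, x \in S' -> 1 < #|[set y in S' | r x y]|.
Proof.
move=> r_sym r_irr; move En: #|S| => n; elim: n S En => [//|n IH] S Sn _ dens.
have [[x xS xdeg]|H] :=
  pselect (exists2 x, x \in S & #|[set y in S | r x y]| <= 1); last first.
  exists S; first by rewrite -card_gt0 Sn.
  by move=> x xS; rewrite ltnNge; apply/negP => ?; apply: H; exists x.
have S'n : #|S :\ x| = n by move: Sn; rewrite (cardsD1 x) xS => -[].
pose D S := [set xy | [&& xy.1 \in S, xy.2 \in S & r xy.1 xy.2]].
pose N := [set y in S | r x y].
have subD : D S \subset
    D (S :\ x) :|: ([set (x, y) | y in N] :|: [set (y, x) | y in N]).
  apply/subsetP => -[u v]; rewrite !in_setU !in_set /= => /and3P [uS vS uv].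
  have [ux|ux] := eqVneq u x.
    apply/or3P/Or32/imsetP; exists v; last by rewrite ux.
    by rewrite inE vS -ux.
  have [vx|vx] := eqVneq v x.
    apply/or3P/Or33/imsetP; exists u; last by rewrite vx.
    by rewrite inE uS r_sym -vx.
  by rewrite !in_set1 ux vx uS vS uv.
have DS : #|D S| <= #|D (S :\ x)| + 2.
  apply: leq_trans (subset_leq_card subD) _.
  apply: leq_trans (leq_card_setU _ _) _; rewrite leq_add2l.
  apply: leq_trans (leq_card_setU _ _) _; rewrite -[2]/(1 + 1)%N; apply: leq_add.
    exact: leq_trans (leq_imset_card _ _) xdeg.
  exact: leq_trans (leq_imset_card _ _) xdeg.
have dens' : 2 * n <= #|D (S :\ x)| by move: dens DS; rewrite -/(D S); lia.
case: n IH Sn S'n dens dens' => [|n] IH Sn S'n dens dens'; last exact: IH dens'.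
have S1 : S = [set x].
  move/eqP: S'n; rewrite cards_eq0 setD_eq0 subset1 => /orP [/eqP //|/eqP S0].
  by rewrite S0 inE in xS.
suff : D S = set0 by move=> D0; move: dens; rewrite -/(D S) D0 cards0.
apply/setP => -[u v]; rewrite !in_set /= S1 !inE.
by apply/negP => /and3P [/eqP -> /eqP ->]; rewrite r_irr.
Qed.

(** The path grows at its front [x]: a new neighbour of [x] in [S] cannot lie on the path, since the
    segment up to it would close a cycle of length at most [g]. *)
Lemma long_path g e r S : symmetric e -> irreflexive e -> girth_gt g e ->
  subrel r e -> symmetric r -> S != set0 ->
  (forall x, x \in S -> 1 < #|[set y in S | r x y]|) ->
  forall k, k <= g -> exists x p, [/\ path r x p, uniq (x :: p) & size p = k].
Proof.
move=> e_sym e_irr girth re r_sym S0 deg k kg.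
suff [x [p [xS xp xp_u szp]]] :
    exists x p, [/\ x \in S, path r x p, uniq (x :: p) & size p = k].
  by exists x, p.
elim: k kg => [_|k IH kg]; first by case/set0Pn: S0 => x xS; exists x, [::].
have [x [p [xS xp xp_u szp]]] := IH (ltnW kg).
(* The second vertex of the path is avoided, as stepping back closes no cycle. For empty [p] the
   default is [x], which is not its own neighbour. *)
have [y yS [xy yNh]] : exists2 y, y \in S & r x y /\ y != head x p.
  have /subsetPn [y] : ~~ ([set y in S | r x y] \subset [set head x p]).
    apply: contraL (deg x xS) => /subset_leq_card.
    by rewrite cards1 -leqNgt.
  by rewrite !inE => /andP [yS xy] yh; exists y.
exists y, (x :: p); split=> //; last by rewrite /= szp.
  by rewrite [path _ _ _]/= r_sym xy.
rewrite cons_uniq xp_u andbT in_cons negb_or; apply/andP; split.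
  by apply: contraTneq (re _ _ xy) => ->; rewrite e_irr.
apply/negP => yp; move: yNh xp xp_u szp; case/splitPr: yp => p1 p2 yNh.
rewrite -cat_rcons cat_path => /andP [xp1 _]; rewrite -cat_cons cat_uniq.
move=> /andP [p1u _]; rewrite size_cat size_rcons => szp.
have : g <= size (rcons p1 y).
  apply: (girth x y) => //; [exact: re|exact: sub_path xp1|by rewrite last_rcons|].
  apply: contra yNh => /(walk_edges_head p1u) yE.
  by rewrite {1}yE headI /=; case: (p1).
by rewrite size_rcons leqNgt (leq_trans _ kg) // ltnS -szp leq_addr.
Qed.

End LongPath.

(** * Branch sets of a minor *)

Section BranchMap.
Variable V : finType.
Implicit Types (G H K : graph V) (phi : V -> option V).

Lemma adj_sym G : symmetric (adj G).
Proof. by move=> x y; rewrite /adj setUC. Qed.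

Lemma adj_wf G x y : adj G x y -> [/\ x \in vert G, y \in vert G & x != y].
Proof.
move=> xy; have /forall_inP/(_ _ xy)/andP [] := edges_wf G.
by rewrite subUset !sub1set cards2 => /andP [-> ->]; case: (x != y).
Qed.

Definition branch_rel G phi (x : V) : rel V :=
  [rel u v | [&& adj G u v, phi u == Some x & phi v == Some x]].

Lemma branch_rel_sym G phi x : symmetric (branch_rel G phi x).
Proof. by move=> u v; congr andb; [exact: adj_sym | exact: andbC]. Qed.

(* The branch set of x is the preimage of [Some x]; deleted vertices are sent
   to [None]. *)
Definition branch_map G H phi : Prop :=
  [/\ forall x, x \in vert H -> phi x = Some x,
      forall u x, phi u = Some x -> x \in vert H /\ connect (branch_rel G phi x) u x
    & forall x y, adj H x y ->
        exists u v, [/\ phi u = Some x, phi v = Some y & adj G u v]].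

(** Deleting an edge keeps the map, deleting a vertex discards its branch set, and contracting uv
    merges the branch set of [v] into that of [u]. *)
Lemma branch_map_step G H K phi : branch_map G H phi -> minor_step H K ->
  exists psi, branch_map G K psi.
Proof.
case=> phi_id phi_conn phi_adj [s sH vK eK|z zH vK eK|u v uv vK eK].
- exists phi; split=> [x|w x /phi_conn|x y]; rewrite ?vK //; first exact: phi_id.
  by rewrite /adj eK in_setD1 => /andP [_]; exact: phi_adj.
- pose psi w := if phi w == Some z then None else phi w.
  have psiE w x : psi w = Some x -> phi w = Some x /\ x != z.
    rewrite /psi; case: eqP => // wz wx; split=> //.
    by apply: contra_not_neq wz => xz; rewrite wx xz.
  have psiI w x : phi w = Some x -> x != z -> psi w = Some x.
    by rewrite /psi => -> /eqP xz; case: (Some x =P Some z) => // -[].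
  exists psi; split=> [x|w x /psiE [wx xz]|x y].
  + by rewrite vK in_setD1 => /andP [xz /phi_id wx]; apply: psiI.
  + have [xH wxc] := phi_conn _ _ wx; split; first by rewrite vK in_setD1 xz.
    apply: connect_sub wxc => a b /and3P [ab /eqP ax /eqP bx]; apply: connect1.
    by rewrite /branch_rel /= ab (psiI _ _ ax) // (psiI _ _ bx) // eqxx.
  + rewrite /adj eK inE => /andP [xy]; rewrite in_set2 negb_or => /andP [zx zy].
    have [a [b [ax bx ab]]] := phi_adj _ _ xy.
    by exists a, b; split=> //; apply: psiI => //; rewrite eq_sym.
- have [uH vH uNv] := adj_wf uv.
  pose psi w := if phi w == Some v then Some u else phi w.
  have psiE w x : phi w = Some x -> psi w = Some (rename u v x).
    move=> wx; rewrite /psi /rename wx.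
    by case: (x =P v) => [->|xv]; case: eqP => // -[].
  have psiN w x : x != u -> psi w = Some x -> phi w = Some x /\ x != v.
    rewrite /psi => xu; case: (phi w =P Some v) => [_ [ux]|wv wx].
      by rewrite ux eqxx in xu.
    by split=> //; apply: contra_not_neq wv => xv; rewrite wx xv.
  have psi_rel x : subrel (branch_rel G phi x) (branch_rel G psi (rename u v x)).
    move=> a b /and3P [ab /eqP ax /eqP bx].
    by rewrite /branch_rel /= ab (psiE _ _ ax) (psiE _ _ bx) eqxx.
  have psi_conn w x : connect (branch_rel G phi x) w x ->
      connect (branch_rel G psi (rename u v x)) w x.
    by apply: connect_sub => a b ab; apply/connect1/psi_rel.
  have ru : rename u v u = u by rewrite /rename (negPf uNv).
  have rv : rename u v v = u by rewrite /rename eqxx.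
  (* An edge of [G] that realises uv joins the two branch sets, so their union is connected. *)
  have vu_conn : connect (branch_rel G psi u) v u.
    have [a [b [au bv ab]]] := phi_adj _ _ uv.
    have := psi_conn _ _ (phi_conn _ _ au).2; rewrite ru => aU.
    have := psi_conn _ _ (phi_conn _ _ bv).2; rewrite rv => bV.
    rewrite (sym_connect_sym (@branch_rel_sym _ _ _)) in bV.
    apply: connect_trans bV (connect_trans _ aU); apply: connect1.
    by rewrite /branch_rel /= adj_sym ab (psiE _ _ au) (psiE _ _ bv) ru rv eqxx.
  exists psi; split=> [x|w x wx|x y].
  + rewrite vK in_setD1 => /andP [xv /phi_id xx].
    by rewrite (psiE _ _ xx) /rename (negPf xv).
  + have [xu|xu] := eqVneq x u; last first.
      have [wx' xv] := psiN _ _ xu wx; have [xH wc] := phi_conn _ _ wx'.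
      split; first by rewrite vK in_setD1 xv.
      by have := psi_conn _ _ wc; rewrite {1}/rename (negPf xv).
    subst x; split; first by rewrite vK in_setD1 uNv.
    move: wx; rewrite /psi; case: (phi w =P Some v) => [wv _|_ wu].
      have := psi_conn _ _ (phi_conn _ _ wv).2; rewrite rv => wV.
      exact: connect_trans wV vu_conn.
    by have := psi_conn _ _ (phi_conn _ _ wu).2; rewrite ru.
  + rewrite /adj eK inE => /andP [/imsetP [s sH xyE] _].
have /forall_inP/(_ _ sH)/andP [_ /cards2P [a [b [_ sE]]]] := edges_wf H.
    rewrite sE in sH; have [a' [b' [aa' bb' ab']]] := phi_adj _ _ sH.
    move: xyE; rewrite /rename_edge sE imsetU !imset_set1.
    case/set2_eq => [[-> ->]|[-> ->]].
      by exists a', b'; rewrite (psiE _ _ aa') (psiE _ _ bb').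
    exists b', a'; rewrite (psiE _ _ aa') (psiE _ _ bb'); split=> //.
    by rewrite setUC.
Qed.

Lemma minor_branch_map G H : minor G H -> exists phi, branch_map G H phi.
Proof.
elim=> [|H' K _ [phi phiP] st]; last exact: branch_map_step phiP st.
exists (fun x => if x \in vert G then Some x else None); split=> [x ->|u x|x y xy].
- by [].
- by case: ifP => // uG [<-]; split=> //; apply: connect0.
- by have [xG yG _] := adj_wf xy; exists x, y; rewrite xG yG.
Qed.

End BranchMap.

Import Order.TTheory GRing.Theory Num.Theory.

Local Open Scope ring_scope.

(** * Weighted walks and distances *)

Section Distances.
Variables (R : realType) (V : finType) (G : wgraph R V).
Implicit Types (x y : V) (p : seq V).

Lemma walk_weight_cons x y p :
  walk_weight G x (y :: p) = weight G [set x; y]%SET + walk_weight G y p.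
Proof. by rewrite /walk_weight /= big_cons. Qed.

Lemma walk_weight_ge0 x p : path (adj G) x p -> 0 <= walk_weight G x p.
Proof.
elim: p x => [|y p IH] x; first by rewrite /walk_weight big_nil.
by case/andP=> xy /IH yp; rewrite walk_weight_cons addr_ge0 ?weight_ge0.
Qed.

Lemma dist_le_walk x p :
  path (adj G) x p -> (dist G x (last x p) <= (walk_weight G x p)%:E)%E.
Proof. by move=> xp; apply: ereal_inf_lbound; exists p. Qed.

(** The distance is an infimum, so a walk is obtained from a strict bound; the summands 1 in later
    bounds provide the slack. *)
Lemma dist_lt_walk x y (c : R) : (dist G x y < c%:E)%E ->
  exists p, [/\ path (adj G) x p, last x p = y & walk_weight G x p < c].
Proof. by move/ereal_inf_lt => [_ [p [xp lp] <-]]; rewrite lte_fin; exists p. Qed.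

End Distances.

(** * The core graph with pendant terminals *)

Section Pendant.
Variables (k : nat) (e : rel 'I_k).
Hypotheses (e_sym : symmetric e) (e_irr : irreflexive e).
Let V : finType := ('I_k * bool)%type.

Definition core (i : 'I_k) : V := (i, false).
Definition term (i : 'I_k) : V := (i, true).

Definition pend_rel : rel V := fun x y =>
  if x.2 || y.2 then (x.2 != y.2) && (x.1 == y.1) else e x.1 y.1.

Lemma core_inj : injective core. Proof. by move=> i j []. Qed.

Lemma pend_sym : symmetric pend_rel.
Proof. by move=> [i []] [j []]; rewrite /pend_rel //= eq_sym. Qed.

Lemma pend_irr : irreflexive pend_rel.
Proof. by move=> [i []]; rewrite /pend_rel /=. Qed.

Lemma pend_term i x : pend_rel (term i) x -> x = core i.
Proof. by case: x => [j []] //= /eqP /= <-. Qed.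

Definition pend_edges : {set {set V}} :=
  [set s : {set V} | [exists x, exists y, pend_rel x y && (s == [set x; y])]].

Lemma pend_edges_wf :
  [forall s in pend_edges, (s \subset [set: V]) && (#|s| == 2%N)].
Proof.
apply/forall_inP => s; rewrite inE => /existsP [x /existsP [y /andP [xy /eqP ->]]].
rewrite subsetT cards2; suff -> : x != y by [].
by apply: contraTneq xy => ->; rewrite pend_irr.
Qed.

Definition pend_graph := Graph pend_edges_wf.

Lemma adj_pend x y : adj pend_graph x y = pend_rel x y.
Proof.
rewrite /adj /= inE; apply/idP/idP => [|xy]; last first.
  by apply/existsP; exists x; apply/existsP; exists y; rewrite xy eqxx.
case/existsP=> u /existsP [v /andP [uv /eqP/set2_eq [[-> ->]|[-> ->]]]] //.
by rewrite pend_sym.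
Qed.

(** Forgetting the flag turns a pendant step into standing still; this transfers the girth of the
    core to the whole graph. *)
Lemma pend_path_core x p : path pend_rel x p -> exists q,
  [/\ path e x.1 q, last x.1 q = (last x p).1, (size q <= size p)%N &
    forall i j, [set i; j] \in walk_edges x.1 q ->
      [set core i; core j] \in walk_edges x p].
Proof.
elim: p x => [|y p IH] x /=; first by exists [::].
case/andP=> xy /IH [q [qP lq sq qE]].
move: xy; rewrite /pend_rel; case: ifP => [_ /andP [_ /eqP ->]|].
  exists q; split=> //; first exact: leqW.
  by move=> i j /qE; rewrite in_cons orbC => ->.
case: x => i []; case: y qP lq qE => j [] //= jq lq qE _ ij.
exists (j :: q); split=> //=; first by rewrite ij.
move=> a b; rewrite !in_cons => /orP [/eqP/set2_eq [[-> ->]|[-> ->]]|/qE ->].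
- by rewrite eqxx.
- by rewrite [[set core j; _]]setUC eqxx.
- by rewrite orbT.
Qed.

(** A terminal has only one neighbour, so a walk between the ends of a pendant edge begins or ends
    with that edge. Walks closing a core edge are projected to the core. *)
Lemma pend_girth g : girth_gt g e -> girth_gt g (adj pend_graph).
Proof.
move=> girth x y p; rewrite adj_pend (eq_path adj_pend) => xy xp lp xyNp.
have [q [xq lq sq qE]] := pend_path_core xp.
apply: leq_trans sq.
case: x xy xp lp xyNp xq lq qE => i [].
  move=> /pend_term -> + lp; case: p lp => [//|z p] lp /= /andP [/pend_term ->].
  by rewrite mem_head.
case: y => j []; last first.
  move=> ij _ lp ijNp iq; rewrite lp => lq qE; apply: girth lq _ => //.
  by apply: contra ijNp; apply: qE.
rewrite pend_sym => /pend_term [<-].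
case/lastP: p => [//|p z]; rewrite last_rcons rcons_path => /andP [_ zp] zE.
move: zp; rewrite zE pend_sym => /pend_term lp.
by rewrite -cats1 walk_edges_cat lp mem_cat /= mem_head orbT.
Qed.

Variables (R : realType) (w : nat).

Definition pend_weight (s : {set V}) : R :=
  if [exists i, term i \in s] then w%:R else 1.

Lemma pend_weight_ge0 s : s \in edges pend_graph -> 0 <= pend_weight s.
Proof. by rewrite /pend_weight; case: ifP. Qed.

Definition pend_wgraph : wgraph R V := WGraph pend_weight_ge0.

Lemma pend_weight_term i x : pend_weight [set term i; x] = w%:R.
Proof. by rewrite /pend_weight; case: existsP => // -[]; exists i; rewrite set21. Qed.

Lemma size_le_walk_weight x p :
  (0 < w)%N -> (size p)%:R <= walk_weight pend_wgraph x p.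
Proof.
move=> w_gt0; elim: p x => [|y p IH] x; first by rewrite /walk_weight big_nil.
rewrite walk_weight_cons /= -add1n natrD lerD //.
by rewrite /pend_weight; case: ifP => //; rewrite ler1n.
Qed.

Lemma walk_weight_term i p : p != [::] -> path (adj pend_graph) (term i) p ->
  w%:R <= walk_weight pend_wgraph (term i) p.
Proof.
case: p => [//|y p] _ /= /andP [_ yp].
rewrite walk_weight_cons /= pend_weight_term lerDl.
exact: (walk_weight_ge0 (G := pend_wgraph)).
Qed.

Definition lift_walk i (p : seq 'I_k) : seq V :=
  core i :: rcons (map core p) (term (last i p)).

Lemma lift_walk_path i p :
  path e i p -> path (adj pend_graph) (term i) (lift_walk i p).
Proof.
move=> ip; rewrite (eq_path adj_pend) /= {1}/pend_rel /= eqxx rcons_path.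
by rewrite path_map last_map {2}/pend_rel /= eqxx !andbT.
Qed.

Lemma last_lift_walk i p : last (term i) (lift_walk i p) = term (last i p).
Proof. by rewrite /= last_rcons. Qed.

Lemma lift_walk_uniq i p :
  p != [::] -> uniq (i :: p) -> uniq (term i :: lift_walk i p).
Proof.
move=> p0 ip; have tNp l q : term l \notin map core q by apply/mapP => -[].
have core_uniq : uniq (map core (i :: p)) by rewrite map_inj_uniq //; exact: core_inj.
rewrite /lift_walk -rcons_cons -map_cons cons_uniq rcons_uniq mem_rcons in_cons.
rewrite negb_or !tNp core_uniq !andbT.
case: p p0 ip {core_uniq} => //= j p _ /andP [iNp _].
by apply: contra iNp => /eqP [->]; rewrite mem_last.
Qed.

Lemma walk_weight_lift i p :
  walk_weight pend_wgraph (term i) (lift_walk i p) = (size p)%:R + w%:R *+ 2.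
Proof.
rewrite walk_weight_cons /= pend_weight_term mulr2n addrCA; congr (_ + _).
elim: p i => [|j p IH] i /=.
  rewrite walk_weight_cons /= setUC pend_weight_term.
  by rewrite /walk_weight big_nil addr0 add0r.
rewrite walk_weight_cons IH /= /pend_weight.
case: existsP => [[l]|_]; first by rewrite !inE !xpair_eqE !andbF.
by rewrite -[(size p).+1]add1n natrD addrA.
Qed.

Lemma dist_term i p : path e i p ->
  (dist pend_wgraph (term i) (term (last i p))
     <= ((size p)%:R + w%:R *+ 2)%:E)%E.
Proof.
move=> ip; rewrite -(walk_weight_lift i) -last_lift_walk.
exact/(dist_le_walk (G := pend_wgraph))/lift_walk_path.
Qed.

Definition terms : {set V} := [set x : V | x.2].

Lemma card_terms : #|terms| = k.
Proof.
rewrite -[RHS]card_ord -(card_imset _ (_ : injective term)).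
  apply: eq_card => -[i b]; rewrite inE; apply/idP/imsetP => [/= ->|[j _ [_ ->]]//].
  by exists i.
by move=> i j [].
Qed.

End Pendant.

(** * The lower bound on the stretch *)

Section LowerBound.
Variables (R : realType) (k w : nat) (e : rel 'I_k).
Hypotheses (e_sym : symmetric e) (e_irr : irreflexive e).
Hypotheses (k_gt0 : (0 < k)%N) (w_ge5 : (5 <= w)%N).
Hypothesis e_girth : girth_gt (4 * w ^ 2) e.
(** Ordered pairs are counted, so this means at least 2k edges. *)
Hypothesis e_dense : (4 * k <= #|[set ij | e ij.1 ij.2]|)%N.

Let V : finType := ('I_k * bool)%type.
Let G := pend_wgraph e_irr R w.
Let T : {set V} := terms k.

Variables (H : wgraph R V) (phi : V -> option V) (alpha : R).
Hypotheses (phiP : branch_map G H phi) (vertH : vert H = T).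
Hypotheses (alphaP : has_stretch G T H alpha) (alpha_lt : alpha < w%:R / 4%:R).

Let G_girth : girth_gt (4 * w ^ 2) (adj G) := pend_girth e_sym e_girth.
Let adjG := adj_pend e_sym e_irr.
Let w_gt0 : (0 < w)%N. Proof. exact: leq_trans w_ge5. Qed.
Let w_sq : (5 * w <= w ^ 2)%N.
Proof. by rewrite expnS expn1 leq_mul2r w_ge5 orbT. Qed.
Let w_ge5R : 5%:R <= w%:R :> R. Proof. by rewrite ler_nat. Qed.

Let branch s := branch_rel G phi s.

(** Distances in [H] dominate those in [G], and the edge ab is itself a walk in [H]. *)
Lemma minor_edge_walk a b : adj H a b -> exists q,
  [/\ path (adj G) a q, last a q = b & walk_weight G a q < weight H [set a; b] + 1].
Proof.
move=> ab; have [aT bT _] := adj_wf ab; rewrite vertH in aT bT.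
apply: dist_lt_walk; have [le_ab _] := alphaP.2 a b aT bT.
apply: le_lt_trans le_ab _.
have abP : path (adj H) a [:: b] by rewrite /= ab.
apply: le_lt_trans (dist_le_walk abP) _; rewrite lte_fin.
by rewrite walk_weight_cons /walk_weight big_nil addr0 ltrDl.
Qed.

(** The lift of [p] bounds the distance in [G], and the stretch then bounds the one in [H]. *)
Lemma minor_walk i p : path e i p -> exists h,
  [/\ path (adj H) (term i) h, last (term i) h = term (last i p) &
    walk_weight H (term i) h < alpha * ((size p)%:R + w%:R *+ 2) + 1].
Proof.
move=> ip; apply: dist_lt_walk.
have [|| _ le_H] := alphaP.2 (term i) (term (last i p)); rewrite ?inE //.
apply: le_lt_trans le_H _.
apply: (@le_lt_trans _ _ (alpha * ((size p)%:R + w%:R *+ 2))%:E).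
  rewrite EFinM; apply: lee_wpmul2l; last exact: dist_term.
  by rewrite lee_fin (le_trans _ alphaP.1).
by rewrite lte_fin ltrDl.
Qed.

Lemma branch_term i : phi (term i) = Some (term i).
Proof. by case: phiP => phi_id _ _; apply: phi_id; rewrite vertH inE. Qed.

(* If a core vertex v belongs to the branch set of a foreign terminal s, then
   the branch set of v's own terminal is a singleton, so s is its only
   neighbour in H: all its H-distances, including that to the terminal of a
   neighbour of v, are at least dist_G(v, s). *)
Lemma branch_radius v s : phi v = Some s -> exists q,
  [/\ path (adj G) v q, last v q = s & (size q <= w ^ 2)%N].
Proof.
have [_ phi_conn phi_adj] := phiP.
case: v => i [] vs.
  by move: vs; rewrite -/(term i) branch_term => -[<-]; exists [::].
have [_ /connectP [[|u q0]]] := phi_conn _ _ vs.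
  move=> _ sE; have [sT _] := phi_conn _ _ vs.
  by move: sT; rewrite vertH sE inE.
rewrite [path _ _ _]/= => /andP [/and3P [vu _ /eqP us] _] _.
have vt : adj G (core i) (term i) by rewrite adjG /pend_rel /= eqxx.
have [-> |s_neq] := eqVneq s (term i).
  exists [:: term i]; split=> //; first by rewrite /= vt.
  by rewrite expn_gt0 w_gt0.
case: u us vu => j [] us; rewrite adjG /pend_rel /=.
  move=> /eqP ij; move: us s_neq; rewrite -/(term j) -ij branch_term => -[->].
    by rewrite eqxx.
move=> ij.
have [|[|s' h] [hP lh hW]] := @minor_walk i [:: j]; first by rewrite /= ij.
  by move: lh ij => /= [->]; rewrite e_irr.
have /andP [ts' s'h] := hP.
have s'E : s' = s.
  have [a [b [ai bs' ab]]] := phi_adj _ _ ts'.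
  (* Any other vertex of this branch set would be reached through [core i], the only neighbour of
     [term i], which belongs to [s]. *)
  have aE : a = term i.
    have [_] := phi_conn _ _ ai; rewrite (sym_connect_sym (@branch_rel_sym _ _ _ _)).
    case/connectP=> [[|z q] //=]; case/andP=> /and3P [+ _ /eqP zi] _ _.
    rewrite adjG => /pend_term zE; move: zi; rewrite zE vs => -[sE].
    by rewrite sE eqxx in s_neq.
  move: ab bs'; rewrite aE adjG => /pend_term ->.
  by rewrite /core vs => -[].
have [q [qP lq qW]] := minor_edge_walk ts'.
(* The length is below alpha (2w + 1) + 3 < w^2/2 + w/4 + 3, which is at most w^2 for w >= 5. *)
exists (term i :: q); split; [by rewrite /= vt qP|by rewrite /= lq|].
have sz := size_le_walk_weight e_irr R (term i) q w_gt0.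
have hW0 := walk_weight_ge0 s'h.
rewrite walk_weight_cons in hW.
rewrite -(ler_nat R) natrX /= -add1n natrD.
move: sz hW0 hW qW w_ge5R alpha_lt alphaP.1; rewrite -/G /=.
set W := walk_weight _ _ _; set W' := walk_weight _ _ _; set ww := weight _ _.
set n : R := (size q)%:R; set x : R := w%:R; rewrite mulr2n.
move=> *; nra.
Qed.

(** The short walk of [branch_radius] might leave the branch set. By induction along a connecting
    walk, the next vertex has a short path inside the branch set; prolonged by one edge, it contains
    the short walk by [girth_cover]. *)
Lemma branch_walk v s : phi v = Some s -> exists q,
  [/\ path (branch s) v q, last v q = s, uniq (v :: q) & (size q <= w ^ 2)%N].
Proof.
have [_ phi_conn _] := phiP => vs; have [_ /connectP [q0]] := phi_conn _ _ vs.
elim: q0 v vs => [|u q0 IH] v vs /=; first by move=> _ ->; exists [::].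
case/andP=> vu uq0 sE; have /and3P [vuG _ /eqP us] := vu.
have [q [uq lq _ szq]] := IH u us uq0 sE.
have [r0 [r0P lr0 szr0]] := branch_radius vs.
have [r [rP r_uniq lr szr]] := uniq_subwalk r0P.
have vq : path (branch s) v (u :: q) by apply/andP.
exists r; split=> //; first 2 last.
- exact: leq_trans szr szr0.
- apply: path_walk_edges => a b ab.
  apply: (walk_edges_path (@branch_rel_sym _ _ _ _) vq).
  apply: (girth_cover (@adj_sym _ G) G_girth rP r_uniq) => //.
  + by apply: sub_path vq => c d /and3P [].
  + by rewrite /= lq lr lr0.
  + have arith m m' n : (m <= m' -> m' <= w ^ 2 -> n <= w ^ 2 ->
        m + n.+1 <= 4 * w ^ 2)%N by move: w_sq w_gt0; clear; lia.
    exact: arith szr szr0 szq.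
- by rewrite lr.
Qed.

Definition internal : rel V := fun u v => (phi u == phi v) && (phi u != None).

Lemma internal_sym : symmetric internal.
Proof.
by move=> u v; rewrite /internal eq_sym; case: eqP => //= ->.
Qed.

Lemma branch_internal s : subrel (branch s) internal.
Proof. by move=> u v /and3P [_ /eqP us /eqP vs]; rewrite /internal us vs eqxx. Qed.

(* Branch sets induce trees: an internal edge joins a vertex to its parent. *)
Lemma card_internal :
  (#|[set ij | e ij.1 ij.2 && internal (core ij.1) (core ij.2)]| <= 2 * k)%N.
Proof.
have /choice [gam gamP] : forall v, exists q, forall s, phi v = Some s ->
    [/\ path (branch s) v q, last v q = s, uniq (v :: q) & (size q <= w ^ 2)%N].
  move=> v; case vs: (phi v) => [s|]; last by exists [::].
  by have [q qP] := branch_walk vs; exists q => _ [<-].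
(* If the next vertex is [term i], then [par i] is [i] itself, which does no harm to the count. *)
pose par i := (head (core i) (gam (core i))).1.
have sub : [set ij | e ij.1 ij.2 && internal (core ij.1) (core ij.2)] \subset
    [set (i, par i) | i : 'I_k] :|: [set (par i, i) | i : 'I_k].
  apply/subsetP => -[i j]; rewrite inE /= => /andP [ij /andP [/eqP iEj]].
  case is': (phi (core i)) iEj => [s|//] /esym js _.
  have [iP li iu szi] := gamP _ _ is'; have [jP lj ju szj] := gamP _ _ js.
  apply/setUP.
  have [ijE|ijN] := boolP ([set core i; core j] \in walk_edges (core i) (gam (core i))).
    by left; apply/imsetP; exists i => //; rewrite /par -(walk_edges_head iu ijE).
  have [jiE|jiN] := boolP ([set core j; core i] \in walk_edges (core j) (gam (core j))).
    by right; apply/imsetP; exists j => //; rewrite /par -(walk_edges_head ju jiE).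
  have adjP u q : path (branch s) u q -> path (adj G) u q.
    by apply: sub_path => c d /and3P [].
  (* Otherwise the two paths would close the edge ij to a cycle of length at most 2w^2 + 1. *)
  have : (4 * w ^ 2 <= size (gam (core i) ++ rev_walk (core j) (gam (core j))))%N.
    apply: (G_girth (x := core i) (y := core j)).
    - by rewrite adjG.
    - rewrite cat_path adjP //= li -lj rev_walk_path ?adjP //.
      exact: adj_sym.
    - by rewrite last_cat li -lj last_rev_walk.
    - rewrite walk_edges_cat mem_cat negb_or ijN li -lj walk_edges_rev.
      by rewrite setUC.
  rewrite size_cat size_rev_walk.
  have arith m n : (m <= w ^ 2 -> n <= w ^ 2 -> 4 * w ^ 2 <= m + n -> False)%N.
    by move: w_sq w_gt0; clear; lia.
  by move/(arith _ _ szi szj).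
apply: leq_trans (subset_leq_card sub) _; apply: leq_trans (leq_card_setU _ _) _.
rewrite mul2n -addnn.
by apply: leq_add; apply: leq_trans (leq_imset_card _ _) _; rewrite card_ord.
Qed.

(** Of at least 4k ordered pairs at most 2k are internal; the other 2k meet the density bound of
    [dense_core]. *)
Lemma crossing_path : exists i p,
  [/\ path [rel x y | e x y && ~~ internal (core x) (core y)] i p,
      uniq (i :: p) & size p = w].
Proof.
set r := [rel x y | _].
have r_sym : symmetric r by move=> i j; rewrite /r /= e_sym internal_sym.
have [|||S S0 Sdeg] := @dense_core _ r setT r_sym.
- by move=> i; rewrite /r /= e_irr.
- by rewrite cardsT card_ord.
- rewrite cardsT card_ord.
  have : (4 * k <= #|[set ij | e ij.1 ij.2 && internal (core ij.1) (core ij.2)]|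
     + #|[set xy | [&& xy.1 \in [set: 'I_k], xy.2 \in [set: 'I_k] & r xy.1 xy.2]]|)%N.
    apply: leq_trans e_dense _; apply: leq_trans _ (leq_card_setU _ _).
    apply/subset_leq_card/subsetP => -[i j]; rewrite !inE /r /= => ->.
    by case: internal.
  have arith a b : (4 * k <= a + b -> a <= 2 * k -> 2 * k <= b)%N.
    by clear; lia.
  by move/arith; apply; exact: card_internal.
apply: (@long_path _ (4 * w ^ 2) e r S) => //; first by move=> i j /andP [].
by move: w_sq; clear; lia.
Qed.

(* Each edge ab of H is realised in G by a path through the two branch sets,
   which crosses between branch sets once; by the girth assumption it contains
   every short path from a to b. *)
Lemma minor_edge_crossing a b : adj H a b -> weight H [set a; b] <= w%:R ^+ 2 ->
  exists q s, [/\ path (adj G) a q, last a q = b,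
    (size q)%:R <= weight H [set a; b] *+ 2, w%:R - 1 <= weight H [set a; b] &
    forall x y, [set x; y] \in walk_edges a q -> internal x y \/ [set x; y] = s].
Proof.
move=> ab abW; have [aT bT aNb] := adj_wf ab; rewrite vertH in aT bT.
have [q0 [q0P lq0 q0W]] := minor_edge_walk ab.
have [q [qP q_uniq lq szq]] := uniq_subwalk q0P.
have [_ _ /(_ _ _ ab) [u [v [ua vb uv]]]] := phiP.
have [gu [guP lgu _ szgu]] := branch_walk ua.
have [gv [gvP lgv _ szgv]] := branch_walk vb.
have sz0 := size_le_walk_weight e_irr R a q0 w_gt0.
have szR : (size q)%:R <= (size q0)%:R :> R by rewrite ler_nat.
(* The ends are distinct terminals, so the walk pays for a pendant edge. *)
have wW : w%:R <= walk_weight G a q0.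
  case: a aT ab abW aNb q0P lq0 q0W sz0 {qP q_uniq lq lgu ua guP} => i [] //.
    move=> _ _ _ aNb q0P lq0 _ _; apply: walk_weight_term => //.
    by apply: contraNneq aNb => q00; rewrite -lq0 q00.
  by rewrite inE.
exists q, [set u; v]; split=> //.
- by rewrite lq.
(* The weight is at least w - 1 >= 1, so doubling it absorbs the slack 1. *)
- by move: sz0 szR wW q0W w_ge5R; rewrite -/G mulr2n; lra.
- by move: wW q0W; lra.
have adjP s z p : path (branch s) z p -> path (adj G) z p.
  by apply: sub_path => c d /and3P [].
have szqN : (size q <= w ^ 2 + 1)%N.
  rewrite -(ler_nat R) natrD natrX.
  by move: sz0 szR q0W abW; rewrite -/G; lra.
move=> x y xy.
have : [set x; y] \in walk_edges a (rev_walk u gu ++ v :: gv).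
  apply: (girth_cover (@adj_sym _ G) G_girth qP q_uniq) => //.
  - rewrite cat_path -{1 2}lgu rev_walk_path; last exact: adj_sym.
    by rewrite (adjP _ _ _ guP) last_rev_walk /= uv (adjP _ _ _ gvP).
  - by rewrite last_cat /= lgv lq lq0.
  - rewrite size_cat size_rev_walk /=.
    have arith m n n' : (m <= w ^ 2 + 1 -> n <= w ^ 2 -> n' <= w ^ 2 ->
        m + (n + n'.+1) <= 4 * w ^ 2)%N by move: w_sq w_gt0; clear; lia.
    exact: arith.
rewrite -{1}lgu walk_edges_cat last_rev_walk mem_cat walk_edges_rev /= in_cons.
case/or3P => [xyu|/eqP -> |xyv]; [left|by right|left].
- exact/branch_internal/(walk_edges_path (@branch_rel_sym _ _ _ _) guP).
- exact/branch_internal/(walk_edges_path (@branch_rel_sym _ _ _ _) gvP).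
Qed.

(** The walks of the single steps are concatenated; [es] collects one candidate crossing edge per
    step of [h]. *)
Lemma minor_walk_crossing a h :
  path (adj H) a h -> walk_weight H a h <= w%:R ^+ 2 ->
  exists q (es : seq {set V}), [/\ path (adj G) a q, last a q = last a h,
    (size q)%:R <= walk_weight H a h *+ 2,
    (w%:R - 1) * (size es)%:R <= walk_weight H a h &
    forall x y, [set x; y] \in walk_edges a q -> internal x y \/ [set x; y] \in es].
Proof.
elim: h a => [|b h IH] a.
  by move=> _ _; exists [::], [::]; rewrite /walk_weight big_nil mulr0 mul0rn.
rewrite [path _ _ _]/= walk_weight_cons => /andP [ab bh] W.
have W1 := weight_ge0 ab; have W2 := walk_weight_ge0 bh.
have [|q1 [s [q1P lq1 sz1 Ws q1E]]] := minor_edge_crossing ab; first by lra.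
have [|q2 [es [q2P lq2 sz2 Wes q2E]]] := IH b bh; first by lra.
exists (q1 ++ q2), (s :: es); split.
- by rewrite cat_path q1P lq1.
- by rewrite last_cat lq1.
- by rewrite size_cat natrD mulrnDl lerD.
- by rewrite /= -add1n natrD mulrDr mulr1 lerD.
- move=> x y; rewrite walk_edges_cat lq1 mem_cat in_cons.
  case/orP=> [/q1E [|->]|/q2E [|->]]; rewrite ?eqxx ?orbT; by [left|right].
Qed.

Lemma stretch_contradiction : False.
Proof.
have [i [p [ip ip_uniq szp]]] := crossing_path.
have ipe : path e i p by apply: sub_path ip => x y /andP [].
have [h [hP lh hW]] := minor_walk ipe.
have hW2 : walk_weight H (term i) h <= w%:R ^+ 2.
  move: hW alpha_lt w_ge5R; rewrite szp mulr2n.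
  by set W := walk_weight _ _ _; set x : R := w%:R => *; nra.
have [q [es [qP lq szq Wes qE]]] := minor_walk_crossing hP hW2.
have core_uniq : uniq (core i :: map (@core k) p).
  by rewrite -map_cons map_inj_uniq //; exact: core_inj.
have sub : {subset walk_edges (core i) (map (@core k) p) <= es}.
  move=> s sp; have [p1 [y [p2 [_ sE]]]] := walk_edges_split sp.
  rewrite sE in sp *; set x := last _ _ in sp *.
  have xyN : ~~ internal x y.
    have n_sym : symmetric [rel u v | ~~ internal u v].
      by move=> u v; rewrite /= internal_sym.
    apply: (walk_edges_path n_sym _ sp).
    by rewrite path_map; apply: sub_path ip => u v /andP [].
  (* The lift of [p] is simple of length w + 2 and [q] has length at most 2w^2, so by the girth [q]
     contains every edge of the lift. *)
  suff /qE [xyI|//] : [set x; y] \in walk_edges (term i) q by rewrite xyI in xyN.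
  apply: (girth_cover (@adj_sym _ G) G_girth (lift_walk_path e_sym e_irr ipe)).
  - apply: lift_walk_uniq ip_uniq.
    by apply: contraTneq w_gt0 => p0; rewrite -szp p0.
  - exact: qP.
  - by rewrite last_lift_walk lq lh.
  - rewrite /lift_walk /= size_rcons size_map szp.
    have : (size q <= 2 * w ^ 2)%N.
      rewrite -(ler_nat R) natrM natrX.
      by move: szq hW2; rewrite mulr2n; lra.
    have arith n : (n <= 2 * w ^ 2 -> (w.+1).+1 + n <= 4 * w ^ 2)%N.
      by move: w_sq w_ge5; clear; lia.
    exact: arith.
  - by rewrite /lift_walk /= in_cons -cats1 walk_edges_cat mem_cat sp orbT.
have : (w <= size es)%N.
  rewrite -szp -(size_map (@core k)).
  rewrite -(size_pairmap (fun y z => [set y; z]%SET) (core i)).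
  by apply: uniq_leq_size => //; apply: walk_edges_uniq.
rewrite -(ler_nat R) szp mulr2n in hW *.
(* These bounds give x^2/4 < x + 1, which fails from x = 5 on. *)
have arith (W x n a : R) : 5%:R <= x -> x <= n -> (x - 1) * n <= W ->
  W < a * (x + (x + x)) + 1 -> a < x / 4%:R -> False.
  by clear szp; nra.
by move=> wn; exact: arith w_ge5R wn Wes hW alpha_lt.
Qed.

End LowerBound.

(** * Choice of the parameters *)

Lemma log2_sqrt_le (R : realType) (k m : nat) :
  (4 <= k)%N -> (k < 2 ^ (m ^ 2))%N ->
  Num.sqrt (log2 k%:R / log2 (log2 k%:R)) <= m%:R :> R.
Proof.
move=> k_ge4 k_lt.
have ln2_gt0 : 0 < ln (2 : R) by rewrite ln_gt0 // ltr1n.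
have log2X n : log2 ((2 ^ n)%:R : R) = n%:R.
  by rewrite /log2 natrX lnXn // -(mulr_natl (ln 2)) mulfK // gt_eqF.
have log2_le (x y : R) : 0 < x -> x <= y -> log2 x <= log2 y.
  move=> x0 xy; rewrite ler_pM2r ?invr_gt0 //.
  by rewrite ler_ln // posrE (lt_le_trans x0).
have logk_ge2 : 2 <= log2 (k%:R : R).
  by rewrite -(log2X 2) log2_le ?ltr0n ?ler_nat.
(* As the denominator is at least 1, the quotient is at most log k. *)
have loglogk_ge1 : 1 <= log2 (log2 (k%:R : R)).
  by rewrite -[leLHS](log2X 1%N) log2_le ?ltr0n.
have logk_le : log2 (k%:R : R) <= (m ^ 2)%:R.
  by rewrite -(log2X (m ^ 2)%N) log2_le ?ltr0n ?ler_nat; lia.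
rewrite -[leRHS]ger0_norm // -sqrtr_sqr ler_wsqrtr // -natrX.
apply: le_trans logk_le; rewrite ler_pdivrMr ?ler_peMr //; lra.
Qed.

Theorem theorem1p1 (R : realType) :
  exists (c : R) (k0 : nat), 0 < c /\
    forall k : nat, (k0 <= k)%N ->
      exists (V : finType) (G : wgraph R V) (T : {set V}),
        [/\ T \subset vert G, #|T| = k &
          forall H : wgraph R V, spr_solution G T H ->
            c * Num.sqrt (log2 k%:R / log2 (log2 k%:R)) <= stretch G T H].
Proof.
suff [k0 k0P] : exists k0 : nat, forall k : nat, (k0 <= k)%N -> exists w : nat,
    [/\ (5 <= w)%N, (4 <= k)%N, (2 * 9 ^ (4 * w ^ 2) <= k)%N
      & (k < 2 ^ ((5 * w) ^ 2))%N].
  (* The square root is at most 5w and the stretch at least w/4, whence the constant 1/20. *)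
  exists 20^-1, k0; split; first by rewrite invr_gt0.
  move=> k /k0P [w [w_ge5 k_ge4 k_large k_small]].
  have g_gt0 : (0 < 4 * w ^ 2)%N by rewrite muln_gt0 expn_gt0 (leq_trans _ w_ge5).
  have k_card : (2 * 9 ^ (4 * w ^ 2) <= #|'I_k|)%N by rewrite card_ord.
  (* Degree 8 yields 4k ordered pairs, and 9 = 8 + 1 is the base of the ball bound. *)
  have [e [e_sym e_irr girth dense]] := large_girth_graph (d := 8) g_gt0 k_card.
  exists ('I_k * bool)%type, (pend_wgraph e_irr R w), (terms k).
  split=> [||H HP]; [exact: subsetT|exact: card_terms|].
  have [alphaP _] := stretch_min HP; have [GH vH _] := HP.
  have [phi phiP] := minor_branch_map GH.
  have [st|] :=
    ltP (stretch (pend_wgraph e_irr R w) (terms k) H) (w%:R / 4); last first.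
    apply: le_trans; have := log2_sqrt_le R k_ge4 k_small.
    by set x := Num.sqrt _; rewrite natrM; lra.
  case: (stretch_contradiction e_sym _ w_ge5 girth _ phiP vH alphaP st).
    exact: leq_trans k_ge4.
  by rewrite card_ord -[8%N]/(2 * 4)%N -mulnA leq_pmul2l in dense.
(* Here [l] stands for the integer part of log k. The factor 17 comes from 2 * 9^(4w^2) <= 2^(16w^2
   + 1) <= 2^(17w^2), and 425 is 17 * 5^2. *)
have [N NP] : exists N : nat, forall l, (N <= l)%N -> exists w : nat,
    [/\ (5 <= w)%N, (17 * w ^ 2 <= l)%N & (l < 17 * w.+1 ^ 2)%N].
  exists 425%N => l l_ge.
  have P5 : exists w, (17 * w ^ 2 <= l)%N by exists 5%N.
  have ub w : (17 * w ^ 2 <= l)%N -> (w <= l)%N by rewrite expnS expn1; nia.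
  case: (ex_maxnP P5 ub) => w wl w_max; exists w; split=> //; first exact: w_max.
  by rewrite ltnNge; apply/negP => /w_max; rewrite ltnn.
exists (2 ^ N.+2)%N => k k_ge.
have k_gt0 : (0 < k)%N by apply: leq_trans k_ge; rewrite expn_gt0.
have Nl : (N.+2 <= trunc_log 2 k)%N by apply: trunc_log_max.
have [w [w_ge5 wl lw]] := NP _ (ltnW (ltnW Nl)).
have lk := trunc_logP (isT : (1 < 2)%N) k_gt0.
exists w; split=> //.
- by apply: leq_trans k_ge; rewrite -[4%N]/(2 ^ 2)%N leq_exp2l.
- apply: leq_trans lk.
  apply: (@leq_trans (2 ^ (17 * w ^ 2))); last by rewrite leq_exp2l.
  apply: (@leq_trans (2 * 16 ^ (4 * w ^ 2))).
    by rewrite leq_mul2l /= leq_exp2r // muln_gt0 expn_gt0 (leq_trans _ w_ge5).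
  rewrite -[16%N]/(2 ^ 4)%N -expnM -expnS leq_exp2l //.
  have : (0 < w ^ 2)%N by rewrite expn_gt0 (leq_trans _ w_ge5).
  by move: (w ^ 2)%N => ww; lia.
- apply: leq_trans (trunc_log_ltn k (isT : (1 < 2)%N)) _; rewrite leq_exp2l //.
  (* What remains is 17(w + 1)^2 <= 25w^2, true from w = 5 on. *)
  apply: leq_trans lw _; move: w_ge5; rewrite !expnS !expn0 !muln1; clear; nia.
Qed.
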